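(* Let $\lambda\in(-2,2)$ and $\eta\in\mathbb{R}$ be fixed, and let $F_\eta:\mathbb{Z}^2\to\mathbb{Z}^2$ be the map $F_\eta(x,y)=(y,-\lfloor \lambda y+x+\eta\rfloor)$. Then $F_\eta$ has infinitely many periodic orbits on $\mathbb{Z}^2$.
   Context: Here $\lfloor\cdot\rfloor$ is the floor function. Equivalently, if $(x,y)=(a_n,a_{n+1})$, then $F_\eta(x,y)=(a_{n+1},a_{n+2})$, where $a_{n+2}$ is the unique integer with $-\eta\le a_{n+2}+\lambda a_{n+1}+a_n<1-\eta$. The map $F_\eta$ is a bijection of $\mathbb{Z}^2$. The orbit of $(x,y)\in\mathbb{Z}^2$ is $(F_\eta^n(x,y))_{n\in\mathbb{Z}}$. It is periodic if there is a positive integer $p$ with $F_\eta^p(x,y)=(x,y)$. Two points of $\mathbb{Z}^2$ lying on the same orbit determine the same orbit, so the claim is that there are infinitely many pairwise distinct (disjoint) periodic orbits. *)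

(* Defs.v *)
From mathcomp Require Import all_boot all_order all_algebra.
From mathcomp Require Import all_classical all_reals.

Set Implicit Arguments.
Unset Strict Implicit.
Unset Printing Implicit Defensive.

Import Order.TTheory GRing.Theory Num.Theory.
Local Open Scope classical_set_scope.
Local Open Scope ring_scope.

Definition F (R : realType) (lambda eta : R) (p : int * int) : int * int :=
  (p.2, - Num.floor (lambda * p.2%:~R + p.1%:~R + eta)).

(* The inverse of [F] (see [FK] and [FinvK]): since [x] is an integer,
   z = - floor (lambda y + x + eta) iff x = - z - floor (lambda y + eta). *)
Definition Finv (R : realType) (lambda eta : R) (p : int * int) : int * int :=
  (- p.2 - Num.floor (lambda * p.1%:~R + eta), p.1).

Lemma floor_shift (R : realType) (a b : R) (x : int) :
  Num.floor (a + x%:~R + b) = Num.floor (a + b) + x.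
Proof. by rewrite addrAC floorDrz ?intr_int// intrKfloor. Qed.

Lemma FK (R : realType) (lambda eta : R) :
  cancel (F lambda eta) (Finv lambda eta).
Proof.
by case=> x y; rewrite /F /Finv /= floor_shift opprK addrAC subrr add0r.
Qed.

Lemma FinvK (R : realType) (lambda eta : R) :
  cancel (Finv lambda eta) (F lambda eta).
Proof.
by case=> y z; rewrite /F /Finv /= floor_shift addrCA subrr addr0 opprK.
Qed.

Lemma F_bij (R : realType) (lambda eta : R) : bijective (F lambda eta).
Proof. exact: Bijective (@FK R lambda eta) (@FinvK R lambda eta). Qed.

(* Iterates F^n for n in Z; note that [Negz n] is the integer - (n + 1). *)
Definition Fiter (R : realType) (lambda eta : R) (n : int) (p : int * int) :
    int * int :=
  match n with
  | Posz k => iter k (F lambda eta) p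
  | Negz k => iter k.+1 (Finv lambda eta) p
  end.

(* Two points on the same orbit determine the same orbit, so an orbit is
   represented by the set of its points rather than by a based sequence. *)
Definition orbit (R : realType) (lambda eta : R) (p : int * int) :
    set (int * int) :=
  [set Fiter lambda eta n p | n in [set: int]].

Definition periodic (R : realType) (lambda eta : R) (p : int * int) : Prop :=
  exists2 k : nat, (0 < k)%N & iter k (F lambda eta) p = p.

Definition periodic_orbits (R : realType) (lambda eta : R) :
    set (set (int * int)) :=
  [set orbit lambda eta p | p in periodic lambda eta].

(* Main.v *)
(* F is conjugate to its inverse by the swap (x, y) -> (y, x), so a non-periodic
   orbit contains at most one symmetric point: a diagonal point (y, y), or a
   point which F maps to its swap. The latter exist in the rows y where
   floor (lambda y + eta) is even.

   Give a lattice point v the weight W v = max (0, M - Q v), where Q is the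
   quadratic form invariant under the rotation approximated by F, suitably
   centred. A non-periodic orbit leaves the support of W, so the weight of its
   symmetric point is at most the total decrease of W along its forward orbit.
   If there were only finitely many periodic points, the total weight of the
   symmetric points would then be at most the sum over v of
   max (0, W v - W (F v)), up to O(M).

   Both sides are of order M^(3/2). In each row the rounding error is constant
   and at most 1/2 in absolute value, so the right side is at most half of the
   sum S over the rows of the maximal weight in the row. The diagonal points
   contribute (sqrt (2 - lambda) / 2) S, and the other symmetric points at least
   e S when rows with an even floor have density at least e. For lambda < 1 the
   diagonal suffices; for lambda > 1 one has e = (lambda - 1) / 2, and
   sqrt eps / 2 + (1 - eps) / 2 > 1 / 2 for eps = 2 - lambda < 1. For lambda = 1
   F^3 is the identity. *)

Require Import Defs.
From mathcomp Require Import all_boot all_order all_algebra.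
From mathcomp Require Import all_classical all_reals.
From mathcomp Require Import zify ring lra.

Set Implicit Arguments.
Unset Strict Implicit.
Unset Printing Implicit Defensive.

Import Order.TTheory GRing.Theory Num.Theory.
Local Open Scope classical_set_scope.
Local Open Scope ring_scope.

(** * Symmetric points of reversible maps *)

Lemma iter_reversal (T : Type) (f g : T -> T) :
  (forall v, f (g (f v)) = g v) ->
  forall n v, iter n f (g (iter n f v)) = g v.
Proof.
by move=> fgf; elim=> [//|n IHn] v; rewrite iterSr [iter n.+1 f v]/= fgf IHn.
Qed.

(** Reversibility gives [f^d (g (f^d q)) = g q]. According to the kinds of symmetry at both ends,
    and after cancelling a common [f] if needed, [q] returns to itself after [2d], [2d - 1] or
    [2d + 1] steps, a positive number if [d] is. *)
Lemma symmetric_same_orbit (T : Type) (f g : T -> T) (q : T) (d : nat) :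
  injective f -> (forall v, f (g (f v)) = g v) ->
  g q = q \/ f q = g q ->
  g (iter d f q) = iter d f q \/ f (iter d f q) = g (iter d f q) ->
  (forall k, (0 < k)%N -> iter k f q <> q) -> d = 0%N.
Proof.
move=> f_inj fgf sq sp nper; case: d sp => // d sp; exfalso.
have := iter_reversal fgf d.+1 q.
case: sp => [->|<-]; rewrite -?[f (iter _ f q)]/(iter d.+2 f q) -iterD;
  case: sq => [->|<-].
- exact: nper.
- by rewrite addnS => /(f_inj (iter (d.+1 + d) f q) q); exact: nper.
- exact: nper.
- by rewrite addnS => /(f_inj (iter (d.+1 + d.+1) f q) q); exact: nper.
Qed.

Lemma symmetric_collision (T : Type) (f g : T -> T) (p q : T) (i j : nat) :
  injective f -> (forall v, f (g (f v)) = g v) ->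
  g p = p \/ f p = g p -> g q = q \/ f q = g q ->
  (forall k, (0 < k)%N -> iter k f p <> p) ->
  (forall k, (0 < k)%N -> iter k f q <> q) ->
  iter i f p = iter j f q -> p = q /\ i = j.
Proof.
move=> f_inj fgf; have fi_inj n : injective (iter n f).
  by elim: n => [//|n IHn] x y /f_inj /IHn.
wlog le_ij : p q i j / (i <= j)%N => [hw sp sq np nq e|sp sq np nq].
  have [le_ij|/ltnW le_ji] := leqP i j; first exact: (hw p q i j).
  by have [-> ->] := hw q p j i le_ji sq sp nq np (esym e).
rewrite -(subnKC le_ij) iterD => /fi_inj def_p.
have d0 : (j - i = 0)%N.
  by apply: (symmetric_same_orbit f_inj fgf sq _ nq); rewrite -def_p.
by rewrite def_p d0 addn0.
Qed.

Lemma ler_sum_sub (R : numDomainType) (T : eqType) (s1 s2 : seq T)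
    (r : T -> R) :
  uniq s1 -> uniq s2 -> (forall v, 0 <= r v) ->
  (forall v, v \notin s2 -> r v = 0) ->
  \sum_(v <- s1) r v <= \sum_(v <- s2) r v.
Proof.
move=> u1 u2 r0 rs2.
have -> : \sum_(v <- s1) r v = \sum_(v <- s1 | v \in s2) r v.
  rewrite [RHS]big_mkcond /=; apply: eq_bigr => v _.
  by case: ifPn => // /rs2.
rewrite -big_filter (perm_big [seq v <- s2 | v \in s1]) /=; last first.
  apply: uniq_perm; rewrite ?filter_uniq// => v.
  by rewrite !mem_filter andbC.
rewrite big_filter big_mkcond /=; apply: ler_sum => v _.
by case: ifP.
Qed.

(** Pigeonhole on the first [size s + 1] iterates, which are distinct. The bound on [i] is uniform
    in [p], so that all forward orbits can be cut at the same length. *)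
Lemma exists_escape (T : eqType) (f : T -> T) (p : T) (s : seq T) :
  injective f -> (forall k, (0 < k)%N -> iter k f p <> p) ->
  exists2 i : nat, (i <= size s)%N & iter i f p \notin s.
Proof.
move=> f_inj nper; apply: contrapT => stay.
have fi_inj n : injective (iter n f).
  by elim: n => [//|n IHn] x y /f_inj /IHn.
pose l := [seq iter i f p | i <- iota 0 (size s).+1].
have : (size l <= size s)%N.
  apply: uniq_leq_size => [|v /mapP[i]].
    rewrite map_inj_uniq ?iota_uniq// => i j e.
    wlog le_ij : i j e / (i <= j)%N => [hw|].
      by have [/hw->|/ltnW /hw->] := leqP i j.
    move: e; rewrite -(subnKC le_ij) iterD => /fi_inj /esym e.
    by case: (posnP (j - i)) => [->|/nper //]; rewrite addn0.
  rewrite mem_iota add0n => /andP[_ i_lt] ->.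
  by apply: contrapT => /negP out; apply: stay; exists i.
by rewrite size_map size_iota ltnn.
Qed.

(* A non-periodic orbit leaves the finite support of W, so W p is at most the
   total decrease of W along the forward orbit of p; by reversibility the
   forward orbits of distinct non-periodic symmetric points are disjoint. *)
Lemma sum_symmetric_le (R : realDomainType) (T : eqType) (f g : T -> T)
    (W : T -> R) (box s : seq T) :
  injective f -> (forall v, f (g (f v)) = g v) ->
  (forall v, 0 <= W v) -> (forall v, v \notin box -> W v = 0) ->
  uniq box -> uniq s ->
  (forall p, p \in s -> g p = p \/ f p = g p) ->
  (forall p, p \in s -> forall k, (0 < k)%N -> iter k f p <> p) ->
  \sum_(p <- s) W p <= \sum_(v <- box) Num.max 0 (W v - W (f v)).
Proof.
move=> f_inj fgf W0 Wbox ubox us s_sym s_nper.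
pose r v := Num.max 0 (W v - W (f v)).
have r0 v : 0 <= r v by rewrite le_max lexx.
have rbox v : v \notin box -> r v = 0.
  by move=> /Wbox Wv; rewrite /r Wv sub0r max_l// oppr_le0.
pose m := size box.
have decrease i p : W p - W (iter i f p) <= \sum_(j <- iota 0 i) r (iter j f p).
  elim: i => [|i IHi]; first by rewrite subrr big_nil.
  rewrite -addn1 iotaD big_cat big_seq1 add0n addn1 /=.
  have : W (iter i f p) - W (f (iter i f p)) <= r (iter i f p).
    by rewrite le_max lexx orbT.
  by move: IHi; lra.
have Wle p : p \in s -> W p <= \sum_(j <- iota 0 m) r (iter j f p).
  move=> ps; have [i le_im /Wbox Wi] := exists_escape box f_inj (s_nper _ ps).
  have := decrease i p; rewrite Wi subr0 => /le_trans; apply.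
  rewrite /m -(subnKC le_im) iotaD big_cat lerDl /=.
  by apply: sumr_ge0 => *; exact: r0.
apply: (@le_trans _ _ (\sum_(p <- s) \sum_(j <- iota 0 m) r (iter j f p))).
  rewrite big_seq [leRHS]big_seq; exact: ler_sum.
rewrite -(@big_allpairs_dep _ _ _ _ _ _ (fun p j => iter j f p) _ _ r) ler_sum_sub//.
apply: allpairs_uniq; rewrite ?iota_uniq// => -[p i] [q j] /=.
move=> /allpairsP[[p' i']] /= [p's _ [-> ->]].
move=> /allpairsP[[q' j']] /= [q's _ [-> ->]].
move=> /(symmetric_collision f_inj fgf (s_sym _ p's) (s_sym _ q's)).
by move=> /(_ (s_nper _ p's) (s_nper _ q's))[-> ->].
Qed.

(** * Periodic orbits *)

Lemma finite_orbit (R : realType) (lambda eta : R) (p : int * int) :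
  periodic lambda eta p -> finite_set (Defs.orbit lambda eta p).
Proof.
move=> [k k_gt0 per].
have perM q : iter (q * k) (F lambda eta) p = p.
  by elim: q => [//|q IHq]; rewrite mulSn iterD IHq per.
have iterF j : iter j (F lambda eta) p = iter (j %% k) (F lambda eta) p.
  by rewrite {1}(divn_eq j k) addnC iterD perM.
have FinvN j : iter j (Finv lambda eta) p = iter (j * k.-1) (F lambda eta) p.
  (* Write [p] as its own iterate of order [j * k = j + j * k.-1]; the [j] inverse steps cancel [j]
     of these. *)
  rewrite -{1}(perM j) -{1}(prednK k_gt0) mulnS iterD.
  elim: j (iter _ _ p) => [//|j IHj] v.
  by rewrite iterSr [iter j.+1 _ v]/= FK IHj.
apply: (sub_finite_set (B := [set` [seq iter j (F lambda eta) p | j <- iota 0 k]])).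
  move=> _ [[j|j] _ <-] /=; rewrite -?iterS ?FinvN iterF;
    apply: (map_f (fun j => iter j (F lambda eta) p));
    by rewrite mem_iota ltn_mod.
by apply/finite_seqP; eexists.
Qed.

(** Each periodic orbit is a finite set, so it is enough to find infinitely many periodic points. *)
Lemma finite_periodic (R : realType) (lambda eta : R) :
  finite_set (periodic_orbits lambda eta) -> finite_set (periodic lambda eta).
Proof.
move=> fin.
apply: (@sub_finite_set _ _ (\bigcup_(O in periodic_orbits lambda eta) O)).
  by move=> p per; exists (Defs.orbit lambda eta p); [exists p|exists 0].
by apply: bigcup_finite => // _ [p per <-]; exact: finite_orbit.
Qed.

(** Three consecutive terms always sum to minus the floor of [eta], so the sequence has period 3. *)
Lemma periodic_lambda1 (R : realType) (eta : R) (p : int * int) :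
  periodic 1 eta p.
Proof.
have FE v : F 1 eta v = (v.2, - (Num.floor eta + (v.2 + v.1))).
  rewrite /F /= mul1r -intrD -[X in Num.floor (X + _)]add0r.
  by rewrite floor_shift add0r.
exists 3%N => //; case: p => x y.
change (F 1 eta (F 1 eta (F 1 eta (x, y))) = (x, y)); rewrite !FE /=.
by congr pair; ring.
Qed.

Lemma infinite_int2 : infinite_set [set: int * int].
Proof.
move=> /finite_seqP[s es].
pose l := [seq (Posz i, Posz 0) | i <- iota 0 (size s).+1].
have : (size l <= size s)%N.
  apply: uniq_leq_size => [|v _].
    by rewrite map_inj_uniq ?iota_uniq// => i j [].
  by have : [set: int * int] v by []; rewrite es.
by rewrite size_map size_iota ltnn.
Qed.

(** * Sums of truncated parabolas *)

Definition clamp (R : realType) (N s : R) : R := Num.max (- N) (Num.min N s).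

(** For [M = codisc lambda * n ^ 2], the supremum of the weight along the real line through a row at
    height [s] from the centre is [codisc lambda * parabola n s]. *)
Definition parabola (R : realType) (N s : R) : R := Num.max 0 (N ^+ 2 - s ^+ 2).

(* [parabola N] is piecewise smooth with primitive [parabola_primitive N]: its
   sums over unit steps are compared with the increments of the primitive. *)
Definition parabola_primitive (R : realType) (N s : R) : R :=
  N ^+ 2 * clamp N s - clamp N s ^+ 3 / 3.

Lemma parabola_ge0 (R : realType) (N s : R) : 0 <= parabola N s.
Proof. by rewrite le_max lexx. Qed.

Lemma parabola_le (R : realType) (N s : R) : parabola N s <= N ^+ 2.
Proof. by rewrite ge_max sqr_ge0 /= gerBl sqr_ge0. Qed.

Lemma parabola_lipschitz (R : realType) (N s : R) : 0 <= N ->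
  `|parabola N (s + 1) - parabola N s| <= 2 * N + 1.
Proof.
move=> N0; rewrite ler_norml /parabola !maxEle.
by do 2! case: ifPn; rewrite -?ltNge => ? ?; apply/andP; split; nra.
Qed.

Lemma parabola_primitive_step (R : realType) (N s : R) : 1 <= N ->
  `|parabola_primitive N (s + 1) - parabola_primitive N s - parabola N s|
    <= 2 * N.
Proof.
move=> N1.
have out r : r <= - N \/ N <= r -> parabola N r = 0.
  by move=> outr; rewrite /parabola max_l //; case: outr => ?; nra.
have ins r : - N <= r <= N -> parabola N r = N ^+ 2 - r ^+ 2.
  by move=> /andP[? ?]; rewrite /parabola max_r //; nra.
have cl_l r : r <= - N -> clamp N r = - N.
  by move=> ?; rewrite /clamp min_r ?max_l //; lra.
have cl_r r : N <= r -> clamp N r = N.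
  by move=> ?; rewrite /clamp min_l ?max_r //; lra.
have cl_i r : - N <= r <= N -> clamp N r = r.
  by move=> /andP[? ?]; rewrite /clamp min_r ?max_r.
rewrite ler_norml /parabola_primitive.
have [s_le|s_gt] := leP s (- N).
  rewrite out; last by left.
  rewrite (cl_l s)//; have [s1|s1] := leP (s + 1) (- N).
    by rewrite cl_l//; apply/andP; split; lra.
  rewrite cl_i; last by apply/andP; split; lra.
  (* [d] is the part of the unit step inside the support; as [1 <= N], the step does not reach past
     the other end. *)
  set d := s + 1 + N; have [d0 d1] : 0 <= d /\ d <= 1 by rewrite /d; lra.
  have -> : s + 1 = d - N by rewrite /d; ring.
  have -> : N ^+ 2 * (d - N) - (d - N) ^+ 3 / 3 -
    (N ^+ 2 * - N - (- N) ^+ 3 / 3) - 0 = d ^+ 2 * (N - d / 3) by field.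
  have : d ^+ 2 <= 1 by nra.
  have : 0 <= d ^+ 2 by exact: sqr_ge0.
  by move: (d ^+ 2) => e ? ?; apply/andP; split; nra.
have [N_le|s_lt] := leP N s.
  rewrite out; last by right.
  rewrite (cl_r (s + 1)); last by lra.
  by rewrite (cl_r s) //; apply/andP; split; lra.
have s_in : - N <= s <= N by rewrite !ltW.
rewrite (ins s)// (cl_i s)//.
have [s1|s1] := leP (s + 1) N.
  rewrite cl_i; last by apply/andP; split; lra.
  have -> : N ^+ 2 * (s + 1) - (s + 1) ^+ 3 / 3 - (N ^+ 2 * s - s ^+ 3 / 3)
    - (N ^+ 2 - s ^+ 2) = - s - 1 / 3 by field.
  by apply/andP; split; lra.
rewrite cl_r; last by lra.
set d := N - s; have [d0 d1] : 0 <= d /\ d <= 1 by rewrite /d; lra.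
have -> : s = N - d by rewrite /d; ring.
have -> : N ^+ 2 * N - N ^+ 3 / 3 - (N ^+ 2 * (N - d) - (N - d) ^+ 3 / 3) -
  (N ^+ 2 - (N - d) ^+ 2) = d ^+ 2 * (N - d / 3) - d * (2 * N - d) by field.
have : d ^+ 2 <= d by nra.
have : 0 <= d ^+ 2 by exact: sqr_ge0.
have -> : d * (2 * N - d) = 2 * (d * N) - d ^+ 2 by ring.
have : d * N <= N by nra.
have : 0 <= d * N by nra.
by move: (d * N) => g; move: (d ^+ 2) => e *; apply/andP; split; nra.
Qed.

(** [4 / 3 * N ^ 3] is the integral of the parabola over its support, which the range of summation
    covers. *)
Lemma sum_parabola (R : realType) (N s : R) (L : nat) :
  1 <= N -> s <= - N -> N <= s + L%:R ->
  `|\sum_(0 <= i < L) parabola N (s + i%:R) - 4 / 3 * N ^+ 3| <= L%:R * (2 * N).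
Proof.
move=> N1 sN Ns.
have total : \sum_(0 <= i < L) (parabola_primitive N (s + i.+1%:R)
    - parabola_primitive N (s + i%:R)) = 4 / 3 * N ^+ 3.
  rewrite (telescope_sumr (fun i => parabola_primitive N (s + i%:R)))//.
  have clL : clamp N (s + L%:R) = N.
    by rewrite /clamp min_l ?max_r //; lra.
  have cl0 : clamp N (s + 0%:R) = - N.
    by rewrite addr0 /clamp min_r ?max_l //; lra.
  by rewrite /parabola_primitive clL cl0; field.
rewrite -total -sumrB; apply: le_trans (ler_norm_sum _ _ _) _.
apply: (@le_trans _ _ (\sum_(0 <= i < L) (2 * N))).
  apply: ler_sum => i _; rewrite distrC -[i.+1%:R]natr1 addrA.
  exact: parabola_primitive_step.
by rewrite sumr_const_nat subn0 -[_ *+ L]mulr_natl.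
Qed.

(* Unit increments dominate [t + 1 / 4] on [-1/4 < t < h], and the total
   variation is [h ^ 2 / 2 + O(h)]. *)
Definition row_primitive (R : realType) (h t : R) : R :=
  (Num.max 0 (Num.min (h + 1) t) + 1) ^+ 2 / 2.

Lemma row_primitive_ge (R : realType) (h t : R) :
  1 / 2 <= row_primitive h t.
Proof.
rewrite /row_primitive.
have : 0 <= Num.max 0 (Num.min (h + 1) t) by rewrite le_max lexx.
by move: (Num.max _ _) => z ?; nra.
Qed.

Lemma row_primitive_le (R : realType) (h t : R) : 0 <= h ->
  row_primitive h t <= (h + 2) ^+ 2 / 2.
Proof.
move=> h0; rewrite /row_primitive.
have : 0 <= Num.max 0 (Num.min (h + 1) t) by rewrite le_max lexx.
have : Num.max 0 (Num.min (h + 1) t) <= h + 1.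
  by rewrite ge_max ge_min lexx /=; lra.
by move: (Num.max _ _) => z ? ?; nra.
Qed.

Lemma row_primitive_step (R : realType) (h t : R) : 0 <= h ->
  (if (t ^+ 2 < h ^+ 2) then Num.max 0 (t + 1 / 4) else 0)
    <= row_primitive h (t + 1) - row_primitive h t.
Proof.
move=> h0; pose m r := Num.max 0 (Num.min (h + 1) r).
have m0 r : 0 <= m r by rewrite le_max lexx.
have mono : m t <= m (t + 1).
  by rewrite /m ge_max !le_max !le_min !ge_min lexx; lra.
have ge0 : 0 <= row_primitive h (t + 1) - row_primitive h t.
  by rewrite /row_primitive -!/(m _); have := m0 t; nra.
case: ifPn => // th; rewrite ge_max ge0 /=.
have [t_le|t_gt] := leP t (- (1 / 4)); first by lra.
have t_lt : t < h by nra.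
rewrite /row_primitive !min_r; [|lra..].
rewrite [Num.max 0 (t + 1)]max_r; last by lra.
rewrite maxEle; case: ifPn => [|_]; first by move=> ?; nra.
by nra.
Qed.

(** With [z = t + i], a positive term is largest at [d = 1 / 2] or [d = - 1 / 2], according to the
    sign of [d], where it is [1 / 4 - z] or [1 / 4 + z]. The bound is the total variation
    [(h + 2) ^ 2 / 2 - 1 / 2] of [row_primitive]. *)
Lemma row_sum (R : realType) (h d t : R) (L : nat) :
  0 <= h -> `|d| <= 1 / 2 ->
  \sum_(0 <= i < L) (if (t + i%:R) ^+ 2 < h ^+ 2
                     then Num.max 0 (d * (d - 2 * (t + i%:R))) else 0)
    <= h ^+ 2 / 2 + 2 * h + 3 / 2.
Proof.
move=> h0; rewrite ler_norml => /andP[d_ge d_le].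
have [d0|d0] := leP 0 d.
  apply: (@le_trans _ _ (\sum_(0 <= i < L) (- row_primitive h (- (t + i.+1%:R) + 1)
     - - row_primitive h (- (t + i%:R) + 1)))).
    apply: ler_sum => i _; rewrite -[i.+1%:R]natr1.
    have := @row_primitive_step _ h (- (t + i%:R)) h0.
    have -> : - (t + (i%:R + 1)) + 1 = - (t + i%:R) by ring.
    rewrite sqrrN opprK [- _ + row_primitive _ _]addrC; apply: le_trans.
    case: ifP => // _; rewrite ge_max !le_max lexx /=.
    by move: (t + _) => z; apply/orP; case: (leP z (1 / 4)) => ?;
      [right; nra|left; nra].
  rewrite (telescope_sumr (fun i => - row_primitive h (- (t + i%:R) + 1)))//.
  have := row_primitive_ge h (- (t + L%:R) + 1).
  have := @row_primitive_le _ h (- (t + 0%:R) + 1) h0.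
  by nra.
apply: (@le_trans _ _ (\sum_(0 <= i < L) (row_primitive h (t + i.+1%:R)
   - row_primitive h (t + i%:R)))).
  apply: ler_sum => i _; rewrite -[i.+1%:R]natr1 addrA.
  have := @row_primitive_step _ h (t + i%:R) h0.
  apply: le_trans.
  case: ifP => // _; rewrite ge_max !le_max lexx /=.
  by move: (t + _) => z; apply/orP; case: (leP z (- (1 / 4))) => ?;
    [left; nra|right; nra].
rewrite (telescope_sumr (fun i => row_primitive h (t + i%:R)))//.
have := row_primitive_ge h (t + 0%:R).
have := @row_primitive_le _ h (t + L%:R) h0.
by nra.
Qed.

(** Summation by parts. Against a parabola of width [n], the increments of a bounded [phi] thus cost
    only O(n^2), while the parabola itself sums to order n^3. *)
Lemma abel_lower (R : realType) (phi h : nat -> R) (C D E : R) (L : nat) :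
  (forall i, `|phi i| <= C) -> (forall i, `|h i.+1 - h i| <= D) ->
  (forall i, 0 <= h i <= E) ->
  - (2 * C * E + L%:R * (C * D)) <= \sum_(0 <= i < L) (phi i.+1 - phi i) * h i.
Proof.
move=> phiC hD hE.
have C0 : 0 <= C by apply: le_trans (phiC 0%N).
have phih i : `|phi i * h i| <= C * E.
  have /andP[h0 h_le] := hE i.
  by rewrite normrM ler_pM// ger0_norm.
apply: (@le_trans _ _ (\sum_(0 <= i < L) ((phi i.+1 * h i.+1 - phi i * h i) - C * D))).
  rewrite sumrB (telescope_sumr (fun i => phi i * h i))// sumr_const_nat subn0.
  rewrite -[_ *+ L]mulr_natl.
  have := phih L; have := phih 0%N; rewrite !ler_norml => /andP[? ?] /andP[? ?].
  by lra.
apply: ler_sum => i _.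
have : `|phi i.+1 * (h i.+1 - h i)| <= C * D by rewrite normrM ler_pM.
by rewrite ler_norml => /andP[? ?]; lra.
Qed.

(** * The energy of a lattice point *)

Definition swap (v : int * int) : int * int := (v.2, v.1).

(* The fixed point of the map obtained by replacing the floor of [z] with
   [z - 1 / 2]; it makes the rounding error lie in [-1/2, 1/2). *)
Definition center (R : realType) (lambda eta : R) : R :=
  (1 / 2 - eta) / (2 + lambda).

Definition energy (R : realType) (lambda eta : R) (v : int * int) : R :=
  let x := v.1%:~R - center lambda eta in
  let y := v.2%:~R - center lambda eta in
  x ^+ 2 + lambda * x * y + y ^+ 2.

Definition weight (R : realType) (lambda eta M : R) (v : int * int) : R :=
  Num.max 0 (M - energy lambda eta v).

Definition row_floor (R : realType) (lambda eta : R) (y : int) : int :=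
  Num.floor (lambda * y%:~R + eta).

(* The rounding error at height [y]: it does not depend on [x]. *)
Definition row_defect (R : realType) (lambda eta : R) (y : int) : R :=
  lambda * y%:~R + eta - (row_floor lambda eta y)%:~R - 1 / 2.

(** Position in the row relative to its real point of least energy. *)
Definition row_shift (R : realType) (lambda eta : R) (v : int * int) : R :=
  v.1%:~R - center lambda eta + lambda / 2 * (v.2%:~R - center lambda eta).

(** Determinant of the quadratic form in [energy]. *)
Definition codisc (R : realType) (lambda : R) : R := 1 - lambda ^+ 2 / 4.

Lemma codisc_gt0 (R : realType) (lambda : R) :
  -2 < lambda < 2 -> 0 < codisc lambda.
Proof. by rewrite /codisc => /andP[? ?]; nra. Qed.

Lemma FE (R : realType) (lambda eta : R) (v : int * int) :
  F lambda eta v = (v.2, - (row_floor lambda eta v.2 + v.1)).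
Proof. by rewrite /F floor_shift. Qed.

Lemma F_swap_F (R : realType) (lambda eta : R) (v : int * int) :
  F lambda eta (swap (F lambda eta v)) = swap v.
Proof. by case: v => x y; rewrite !FE /swap /=; congr pair; ring. Qed.

Lemma row_defect_bound (R : realType) (lambda eta : R) (y : int) :
  `|row_defect lambda eta y| <= 1 / 2.
Proof.
rewrite /row_defect /row_floor.
have := floor_itv (lambda * y%:~R + eta); rewrite intrD => /andP[? ?].
by rewrite ler_norml; apply/andP; split; lra.
Qed.

Lemma energy_swap (R : realType) (lambda eta : R) (v : int * int) :
  energy lambda eta (swap v) = energy lambda eta v.
Proof. by rewrite /energy /=; ring. Qed.

Lemma energy_row (R : realType) (lambda eta : R) (v : int * int) :
  energy lambda eta v = row_shift lambda eta v ^+ 2 +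
    codisc lambda * (v.2%:~R - center lambda eta) ^+ 2.
Proof. by rewrite /energy /row_shift /codisc /=; field. Qed.

(** In centred coordinates [F] is the linear map [(x, y) -> (y, - lambda y - x)], which preserves
    the form, followed by adding the row defect to the second coordinate. *)
Lemma energy_F (R : realType) (lambda eta : R) (v : int * int) :
  2 + lambda != 0 ->
  energy lambda eta (F lambda eta v) - energy lambda eta v =
  row_defect lambda eta v.2 *
    (row_defect lambda eta v.2 - 2 * row_shift lambda eta v).
Proof.
move=> nz; rewrite /energy FE /row_shift /row_defect /= rmorphN rmorphD /=.
have : center lambda eta * (2 + lambda) = 1 / 2 - eta by rewrite divfK.
move: (center lambda eta) (row_floor lambda eta v.2)%:~R => c f def_c.
have -> : eta = 1 / 2 - c * (2 + lambda) by rewrite def_c; ring.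
by field.
Qed.

Lemma weight_ge0 (R : realType) (lambda eta M : R) (v : int * int) :
  0 <= weight lambda eta M v.
Proof. by rewrite le_max lexx. Qed.

(** * Finite boxes of lattice points *)

Definition ints (B : nat) : seq int :=
  [seq i%:Z - B%:Z | i <- index_iota 0 (B.*2.+1)].

Lemma mem_ints (B : nat) (x : int) : (x \in ints B) = (`|x| <= B%:Z).
Proof.
apply/mapP/idP => [[i]|x_le]; first by rewrite mem_index_iota => ? ->; lia.
by exists `|(x + B%:Z)%R|%N; [rewrite mem_index_iota; lia|lia].
Qed.

Lemma ints_uniq (B : nat) : uniq (ints B).
Proof. by rewrite map_inj_uniq ?iota_uniq// => i j; lia. Qed.

Lemma sum_ints (R : nmodType) (B : nat) (g : int -> R) :
  \sum_(y <- ints B) g y = \sum_(0 <= i < B.*2.+1) g (i%:Z - B%:Z).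
Proof. exact: big_map. Qed.

(** Rows are outermost, so that a sum over the box splits into row sums. *)
Definition box (B : nat) : seq (int * int) :=
  [seq (x, y) | y <- ints B, x <- ints B].

Lemma box_uniq (B : nat) : uniq (box B).
Proof.
apply: allpairs_uniq; rewrite ?ints_uniq// => -[y x] [y' x'] /= _ _.
by case=> -> ->.
Qed.

Lemma mem_box (B : nat) (v : int * int) :
  (v \in box B) = (v.1 \in ints B) && (v.2 \in ints B).
Proof.
apply/allpairsP/andP => [[[y x] /= [? ? ->]]//|[xB yB]].
by exists (v.2, v.1); split=> //; case: v {xB yB}.
Qed.

(** Inside the ellipse, truncation can only raise the weight of the image, so the decrease is at
    most the energy gain; outside, the weight is already 0. *)
Lemma weight_decrease (R : realType) (lambda eta M : R) (v : int * int) :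
  2 + lambda != 0 ->
  Num.max 0 (weight lambda eta M v - weight lambda eta M (F lambda eta v)) <=
  if energy lambda eta v < M
  then Num.max 0 (row_defect lambda eta v.2 *
         (row_defect lambda eta v.2 - 2 * row_shift lambda eta v))
  else 0.
Proof.
move=> nz; have W'0 := weight_ge0 lambda eta M (F lambda eta v).
have := energy_F eta v nz.
case: ifPn => [lt_M eF|]; last first.
  rewrite -leNgt => le_M _; rewrite max_l// {1}/weight max_l; lra.
rewrite ge_max le_max lexx /= le_max; apply/orP; right.
rewrite -eF {1}/weight max_r; last by rewrite subr_ge0 ltW.
have : M - energy lambda eta (F lambda eta v) <= weight lambda eta M (F lambda eta v).
  by rewrite /weight le_max lexx orbT.
by lra.
Qed.

Lemma row_decrease (R : realType) (lambda eta n : R) (B : nat) (y : int) :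
  -2 < lambda < 2 -> 0 <= n ->
  \sum_(x <- ints B)
    Num.max 0 (weight lambda eta (codisc lambda * n ^+ 2) (x, y) -
      weight lambda eta (codisc lambda * n ^+ 2) (F lambda eta (x, y))) <=
  codisc lambda * parabola n (y%:~R - center lambda eta) / 2 + (2 * n + 3 / 2).
Proof.
move=> lam n0; have /ltW := codisc_gt0 lam.
have k1 : codisc lambda <= 1 by rewrite /codisc; nra.
move: lam => /andP[lam_gt lam_lt] k0.
have nz : 2 + lambda != 0 by rewrite gt_eqF//; lra.
set k := codisc lambda in k0 k1 *.
set s := y%:~R - center lambda eta.
(* Half-width, in terms of [row_shift], of the ellipse [energy < codisc lambda * n ^ 2] in this row;
   it is 0 if the row misses the ellipse. *)
pose h := Num.sqrt (k * parabola n s).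
have h0 : 0 <= h by exact: sqrtr_ge0.
have h2 : h ^+ 2 = k * parabola n s.
  by rewrite sqr_sqrtr// mulr_ge0// parabola_ge0.
have h_le : h <= n.
  have := parabola_le n s; have := parabola_ge0 n s => ? ?.
  by rewrite -(ler_pXn2r (_ : 0 < 2)%N) ?nnegrE// h2; nra.
rewrite sum_ints; set d := row_defect lambda eta y.
pose t := row_shift lambda eta (- B%:Z, y).
apply: (@le_trans _ _ (\sum_(0 <= i < B.*2.+1) (if (t + i%:R) ^+ 2 < h ^+ 2
                     then Num.max 0 (d * (d - 2 * (t + i%:R))) else 0))).
  apply: ler_sum => i _; apply: le_trans (weight_decrease _ _ _ nz) _.
  have -> : row_shift lambda eta (i%:Z - B%:Z, y) = t + i%:R.
    by rewrite /t /row_shift /= rmorphB rmorphN /=; ring.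
  rewrite -/d; case: ifPn => [lt_M|_]; last first.
    by case: ifP => // _; rewrite le_max lexx.
  rewrite ifT// h2; move: lt_M; rewrite energy_row -/k.
  have -> : row_shift lambda eta (i%:Z - B%:Z, y) = t + i%:R.
    by rewrite /t /row_shift /= rmorphB rmorphN /=; ring.
  rewrite /= -/s.
  have : n ^+ 2 - s ^+ 2 <= parabola n s by rewrite le_max lexx orbT.
  by nra.
have := row_sum t B.*2.+1 h0 (row_defect_bound lambda eta y).
by rewrite -/d h2 => /le_trans; apply; lra.
Qed.

(** On the diagonal the energy is [2 + lambda] times the squared distance of [y] to the centre, and
    [codisc lambda = (2 + lambda) * sigma ^ 2]. *)
Lemma weight_diag (R : realType) (lambda eta n sigma : R) (y : int) :
  -2 < lambda -> sigma ^+ 2 = (2 - lambda) / 4 ->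
  weight lambda eta (codisc lambda * n ^+ 2) (y, y) =
  (2 + lambda) * parabola (sigma * n) (y%:~R - center lambda eta).
Proof.
move=> lam_gt sigma2; rewrite /weight /codisc /parabola /energy /=.
rewrite maxr_pMr ?mulr0; last by lra.
by congr Num.max; rewrite exprMn sigma2; field.
Qed.

(* When [row_floor] is even this is the pair (a_n, a_(n+1)) with second
   coordinate y and a_n = a_(n+2). *)
Definition half_turn (R : realType) (lambda eta : R) (y : int) : int * int :=
  (- (row_floor lambda eta y %/ 2)%Z, y).

Lemma F_half_turn (R : realType) (lambda eta : R) (y : int) :
  (2 %| row_floor lambda eta y)%Z ->
  F lambda eta (half_turn lambda eta y) = swap (half_turn lambda eta y).
Proof.
by move=> ev; rewrite FE /swap /=; congr pair; rewrite -{1}(divzK ev); ring.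
Qed.

(** The [row_shift] of this point is half the row defect, at most 1/4 in absolute value, so its
    weight is within 1/16 of the row supremum. *)
Lemma weight_half_turn (R : realType) (lambda eta n : R) (y : int) :
  -2 < lambda < 2 -> (2 %| row_floor lambda eta y)%Z ->
  codisc lambda * parabola n (y%:~R - center lambda eta) - 1 / 16 <=
  weight lambda eta (codisc lambda * n ^+ 2) (half_turn lambda eta y).
Proof.
move=> lam ev; have /ltW := codisc_gt0 lam.
move: lam => /andP[lam_gt lam_lt] k0; rewrite /weight energy_row /=.
have -> : row_shift lambda eta (half_turn lambda eta y) = row_defect lambda eta y / 2.
  have : center lambda eta * (2 + lambda) = 1 / 2 - eta.
    by rewrite divfK// gt_eqF//; lra.
  rewrite /row_shift /row_defect /half_turn /=.
  rewrite -{2}(divzK ev) rmorphN rmorphM /=.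
  move: (center _ _) (_ %/ _)%Z%:~R => c f def_c.
  have -> : eta = 1 / 2 - c * (2 + lambda) by rewrite def_c; ring.
  by field.
have := row_defect_bound lambda eta y; rewrite ler_norml.
move: (row_defect _ _ _) (_ - center _ _) => d s /andP[? ?].
move: (codisc lambda) k0 => k k0.
rewrite /parabola le_max; case: (leP 0 (n ^+ 2 - s ^+ 2)) => [ge0|lt0].
  by apply/orP; right; nra.
by apply/orP; left; lra.
Qed.

Lemma weight_out (R : realType) (lambda eta : R) (n b : nat) (v : int * int) :
  -2 < lambda < 2 -> `|center lambda eta| <= b%:R ->
  v \notin box (n + b) ->
  weight lambda eta (codisc lambda * n%:R ^+ 2) v = 0.
Proof.
move=> lam cb; have k0 := codisc_gt0 lam.
have out w : w.2 \notin ints (n + b) ->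
    weight lambda eta (codisc lambda * n%:R ^+ 2) w = 0.
  rewrite mem_ints -ltNge => w_gt; rewrite /weight energy_row max_l//.
  have : n%:R + b%:R < `|w.2%:~R| :> R.
    by rewrite -natrD [X in X < _]pmulrn -intr_norm ltr_int.
  have : 0 <= n%:R :> R by exact: ler0n.
  move: (row_shift _ _ _) (w.2%:~R) => t y n0 nby.
  have : n%:R <= `|y - center lambda eta|.
    by have := ler_distD (center lambda eta) y 0; rewrite !subr0; lra.
  move=> n_le; have : n%:R ^+ 2 <= (y - center lambda eta) ^+ 2.
    by rewrite -[leRHS]real_normK ?num_real// ler_pXn2r ?nnegrE.
  by have := sqr_ge0 t; nra.
(* The energy is invariant under the swap, so the bound for the second coordinate also serves the
   first. *)
rewrite mem_box negb_and => /orP[v1|]; last exact: out.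
by rewrite /weight -energy_swap; exact: (out (swap v)).
Qed.

(* For lambda = 2 - eps the phase [u] moves by - eps at each step and the parity
   of [row_floor] changes exactly when it wraps around. This piecewise linear
   function of the phase modulo 2 is a transfer function showing that even rows
   have density at least (1 - eps) / 2. *)
Definition defect_phase (R : realType) (lambda eta : R) (y : int) : R :=
  let u := row_defect lambda eta y + 1 / 2 in
  let eps := 2 - lambda in
  if (2 %| row_floor lambda eta y)%Z then - 1 - (1 + eps) / (2 * eps) * u
  else - ((1 + eps) / (2 * eps)) + (1 - eps) / (2 * eps) * u.

Lemma defect_phase_step (R : realType) (lambda eta : R) (y : int) :
  1 < lambda < 2 ->
  (lambda - 1) / 2 + (defect_phase lambda eta (y + 1) - defect_phase lambda eta y)
    <= (2 %| row_floor lambda eta y)%Z%:R.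
Proof.
move=> /andP[lam_gt lam_lt].
have := row_defect_bound lambda eta y; rewrite ler_norml.
(* With [u = d + 1 / 2], where [d] is the defect, the condition reads [eps <= u]: the phase does not
   wrap and parity is kept. *)
have fl : row_floor lambda eta (y + 1) =
  row_floor lambda eta y + (if 3 / 2 - lambda <= row_defect lambda eta y then 2 else 1).
  rewrite /row_floor; apply/floor_def; rewrite -/(row_floor _ _ _).
  have := row_defect_bound lambda eta y.
  have := floor_itv (lambda * y%:~R + eta);
    rewrite -/(row_floor _ _ _) intrD => /andP[? ?].
  rewrite /row_defect ler_norml => /andP[? ?].
  rewrite !rmorphD /=; case: ifPn; rewrite -?ltNge => ?; lra.
have def1 : row_defect lambda eta (y + 1) = row_defect lambda eta y + lambda -
    (if 3 / 2 - lambda <= row_defect lambda eta y then 2 else 1).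
  rewrite {1 2}/row_defect fl !rmorphD /=; case: ifP => _; ring.
have dvd2 f : (2 %| f + 2)%Z = (2 %| f)%Z by lia.
have dvd1 f : (2 %| f + 1)%Z = ~~ (2 %| f)%Z by lia.
rewrite /defect_phase def1 fl => /andP[d_ge d_le].
set a := (1 + (2 - lambda)) / (2 * (2 - lambda)).
have -> : (1 - (2 - lambda)) / (2 * (2 - lambda)) = a - 1.
  by rewrite /a; field; rewrite gt_eqF//; lra.
have ae : a * (2 - lambda) = (1 + (2 - lambda)) / 2.
  by rewrite /a; field; rewrite gt_eqF//; lra.
have a_ge : 1 <= a.
  by rewrite /a ler_pdivlMr; lra.
move: (row_floor _ _ _) (row_defect _ _ _) a ae a_ge d_ge d_le {fl def1} => f d a.
rewrite /= => ae a_ge d_ge d_le.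
(* Here [2 * a - 1 = 1 / eps]. Without a wrap the claim is an equality; at a wrap it reduces to
   [u / eps <= 1] (even [f]) or [0 <= u / eps] (odd [f]). *)
have u0 : 0 <= (2 * a - 1) * (d + 1 / 2) by rewrite mulr_ge0//; lra.
case: (leP (3 / 2 - lambda) d) => d_case; rewrite ?dvd1 ?dvd2.
  by case: (2 %| f)%Z => /=; lra.
have : 0 <= (2 * a - 1) * (3 / 2 - lambda - d) by rewrite mulr_ge0//; lra.
by case: (2 %| f)%Z => /=; lra.
Qed.

Lemma defect_phase_bound (R : realType) (lambda eta : R) (y : int) :
  1 < lambda < 2 ->
  `|defect_phase lambda eta y| <= 1 + (1 + (2 - lambda)) / (2 * (2 - lambda)).
Proof.
move=> /andP[lam_gt lam_lt]; rewrite /defect_phase /=.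
set a := (1 + (2 - lambda)) / (2 * (2 - lambda)).
have -> : (1 - (2 - lambda)) / (2 * (2 - lambda)) = a - 1.
  by rewrite /a; field; rewrite gt_eqF//; lra.
have a_ge : 1 <= a by rewrite /a ler_pdivlMr; lra.
have := row_defect_bound lambda eta y; rewrite ler_norml => /andP[? ?].
move: a a_ge => a a_ge.
have ? : 0 <= a * (row_defect lambda eta y + 1 / 2) by rewrite mulr_ge0//; lra.
have ? : 0 <= a * (1 / 2 - row_defect lambda eta y) by rewrite mulr_ge0//; lra.
by case: ifP => _; rewrite ler_norml; apply/andP; split; nra.
Qed.

(** * Energy balance *)

Lemma weight_le (R : realType) (lambda eta n : R) (v : int * int) :
  -2 < lambda < 2 ->
  weight lambda eta (codisc lambda * n ^+ 2) v <= codisc lambda * n ^+ 2.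
Proof.
move=> /codisc_gt0/ltW k0; rewrite /weight energy_row ge_max gerBl.
by rewrite mulr_ge0 ?sqr_ge0// addr_ge0 ?sqr_ge0// mulr_ge0 ?sqr_ge0.
Qed.

Lemma sum_le_off_sum_add (R : numDomainType) (T : eqType) (W : T -> R) (M : R)
    (s l : seq T) :
  uniq s -> uniq l -> (forall v, 0 <= W v <= M) ->
  \sum_(v <- l) W v <= \sum_(v <- l | v \notin s) W v + (size s)%:R * M.
Proof.
move=> us ul WM; rewrite (bigID (mem s)) /= addrC lerD2l.
rewrite big_mkcond /=.
apply: (@le_trans _ _ (\sum_(v <- s) if v \in s then W v else 0)).
  apply: ler_sum_sub => // v; last by move=> /negbTE->.
  by case: ifP => // _; case/andP: (WM v).
apply: (@le_trans _ _ (\sum_(v <- s) M)).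
  by rewrite big_seq [leRHS]big_seq; apply: ler_sum => v ->; case/andP: (WM v).
by rewrite big_const_seq count_predT iter_addr_0 mulr_natl.
Qed.

Lemma sum_symmetric_weight (R : realType) (lambda eta : R) (n b : nat)
    (s : seq (int * int)) :
  -2 < lambda < 2 -> `|center lambda eta| <= b%:R ->
  uniq s -> (forall v, periodic lambda eta v -> v \in s) ->
  \sum_(y <- ints (n + b))
      weight lambda eta (codisc lambda * n%:R ^+ 2) (y, y) +
  \sum_(y <- ints (n + b) | (2 %| row_floor lambda eta y)%Z)
      weight lambda eta (codisc lambda * n%:R ^+ 2) (half_turn lambda eta y) <=
  \sum_(v <- box (n + b))
      Num.max 0 (weight lambda eta (codisc lambda * n%:R ^+ 2) v -
        weight lambda eta (codisc lambda * n%:R ^+ 2) (F lambda eta v)) +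
  2 * (size s)%:R * (codisc lambda * n%:R ^+ 2).
Proof.
move=> lam cb us s_per; set W := weight lambda eta _; set M := _ * _ ^+ 2.
have WM v : 0 <= W v <= M by rewrite weight_ge0 weight_le.
pose diag := [seq (y, y) | y <- ints (n + b)].
pose half := [seq half_turn lambda eta y |
  y <- [seq y <- ints (n + b) | (2 %| row_floor lambda eta y)%Z]].
have -> : \sum_(y <- ints (n + b)) W (y, y) = \sum_(v <- diag) W v.
  by rewrite [RHS]big_map.
have -> : \sum_(y <- ints (n + b) | (2 %| row_floor lambda eta y)%Z)
    W (half_turn lambda eta y) = \sum_(v <- half) W v.
  by rewrite [RHS]big_map big_filter.
have udiag : uniq diag by rewrite map_inj_uniq ?ints_uniq// => y z [].
have uhalf : uniq half.
  by rewrite map_inj_uniq ?filter_uniq ?ints_uniq// => y z [].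
have := sum_le_off_sum_add us udiag WM; have := sum_le_off_sum_add us uhalf WM.
suff : \sum_(v <- diag | v \notin s) W v + \sum_(v <- half | v \notin s) W v <=
    \sum_(v <- box (n + b)) Num.max 0 (W v - W (F lambda eta v)) by lra.
have diag_sym v : v \in diag -> swap v = v by move=> /mapP[y _ ->].
have half_sym v : v \in half -> F lambda eta v = swap v.
  by move=> /mapP[y]; rewrite mem_filter => /andP[ev _] ->; exact: F_half_turn.
rewrite -[X in X + _]big_filter -[X in _ + X]big_filter -big_cat.
apply: (@sum_symmetric_le _ _ _ swap) => //.
- exact: can_inj (@FK R lambda eta).
- exact: F_swap_F.
- by move=> v; exact: weight_ge0.
- by move=> v; exact: weight_out.
- exact: box_uniq.
(* A diagonal point that is also a half-turn point is fixed by [F], hence periodic, hence in [s]. *)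
- rewrite cat_uniq (filter_uniq _ udiag) (filter_uniq _ uhalf) andbT.
  apply/negP => /hasP[v].
  rewrite mem_filter => /andP[/negP vs /half_sym Fv] v_diag; apply: vs.
  have : v \in [seq v <- diag | v \notin s] := v_diag.
  rewrite mem_filter => /andP[_ /diag_sym sv].
  by apply: s_per; exists 1%N => //=; rewrite Fv.
- move=> p; rewrite mem_cat !mem_filter.
  by case/orP => /andP[_ ?]; [left; exact: diag_sym|right; exact: half_sym].
- move=> p; rewrite mem_cat !mem_filter -andb_orr => /andP[/negP ps _] k k_gt0.
  by move=> per; apply: ps; apply: s_per; exists k.
Qed.

Lemma natr_width (R : realType) (n b : nat) :
  ((n + b).*2.+1)%:R = 2 * (n%:R + b%:R) + 1 :> R.
Proof. by rewrite -natr1 -mul2n natrM natrD. Qed.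

Lemma sum_rows (R : realType) (N c : R) (n b : nat) :
  1 <= N -> N <= n%:R -> `|c| <= b%:R ->
  `|\sum_(y <- ints (n + b)) parabola N (y%:~R - c) - 4 / 3 * N ^+ 3| <=
    (2 * (n%:R + b%:R) + 1) * (2 * N).
Proof.
move=> N1 Nn; rewrite ler_norml => /andP[c_ge c_le].
rewrite sum_ints -natr_width.
have -> : \sum_(0 <= i < (n + b).*2.+1) parabola N ((i%:Z - (n + b)%:Z)%:~R - c)
    = \sum_(0 <= i < (n + b).*2.+1) parabola N (- (n%:R + b%:R) - c + i%:R).
  apply: eq_bigr => i _; congr parabola.
  by rewrite rmorphB /= -natrD; ring.
by apply: sum_parabola => //; rewrite ?natr_width; lra.
Qed.

(** The hypothesis on [phi] makes [e] a lower density of the even rows, up to a coboundary, whose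
    sum against the parabola is handled by [abel_lower]. *)
Lemma half_turn_sum (R : realType) (lambda eta e C : R) (phi : int -> R)
    (n b : nat) :
  -2 < lambda < 2 -> (forall y, `|phi y| <= C) ->
  (forall y, e + (phi (y + 1) - phi y) <= (2 %| row_floor lambda eta y)%Z%:R) ->
  codisc lambda *
    (e * \sum_(y <- ints (n + b)) parabola n%:R (y%:~R - center lambda eta)
     - (2 * C * n%:R ^+ 2 +
        (2 * (n%:R + b%:R) + 1) * (C * (2 * n%:R + 1))))
    - (2 * (n%:R + b%:R) + 1) / 16 <=
  \sum_(y <- ints (n + b) | (2 %| row_floor lambda eta y)%Z)
      weight lambda eta (codisc lambda * n%:R ^+ 2) (half_turn lambda eta y).
Proof.
move=> lam phiC step; have k0 := ltW (codisc_gt0 lam).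
set par := fun y : int => parabola n%:R (y%:~R - center lambda eta).
pose ev y := (2 %| row_floor lambda eta y)%Z.
have par0 y : 0 <= par y by exact: parabola_ge0.
apply: (@le_trans _ _ (\sum_(y <- ints (n + b))
    (codisc lambda * (e * par y + (phi (y + 1) - phi y) * par y) - 1 / 16))).
  rewrite sumrB -mulr_sumr big_split /= -mulr_sumr.
  have -> : \sum_(y <- ints (n + b)) (1 / 16 : R) = (2 * (n%:R + b%:R) + 1) / 16.
    by rewrite sum_ints sumr_const_nat subn0 -[_ *+ _]mulr_natl natr_width; field.
  rewrite lerD2r ler_wpM2l// lerD2l sum_ints.
  have := @abel_lower R (fun i => phi (i%:Z - (n + b)%:Z))
    (fun i => par (i%:Z - (n + b)%:Z)) C (2 * n%:R + 1) (n%:R ^+ 2) (n + b).*2.+1.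
  rewrite natr_width; set S := (X in _ -> _ -> _ -> _ <= X).
  have -> : S = \sum_(0 <= i < (n + b).*2.+1)
    (phi (i%:Z - (n + b)%:Z + 1) - phi (i%:Z - (n + b)%:Z)) * par (i%:Z - (n + b)%:Z).
    by apply: eq_bigr => i _; congr ((phi _ - _) * _); lia.
  apply => [i|i|i]; first exact: phiC.
    have -> : i.+1%:Z - (n + b)%:Z = i%:Z - (n + b)%:Z + 1 by lia.
    rewrite /par [_ - center _ _](_ : _ =
      ((i%:Z - (n + b)%:Z)%:~R - center lambda eta) + 1).
      by apply: parabola_lipschitz; exact: ler0n.
    by rewrite rmorphD /=; ring.
  by rewrite par0 parabola_le.
rewrite [leRHS]big_mkcond /=; apply: ler_sum => y _.
have := step y; rewrite -/(ev y); case: ifPn => evy /= stepy.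
  have := weight_half_turn n%:R lam evy; rewrite -/(par y).
  apply: le_trans; rewrite lerD2r ler_wpM2l//.
  by have := par0 y; nra.
have : codisc lambda * (e * par y + (phi (y + 1) - phi y) * par y) <= 0; last by lra.
by rewrite mulr_ge0_le0// -mulrDl mulr_le0_ge0.
Qed.

(** In units of [4 / 3 * k * N ^ 3], the diagonal contributes [sigma], the half-turn points at least
    [e] and the decrease at most [1 / 2]; the right side collects the errors. *)
Lemma energy_balance (R : realType) (lambda eta e C sigma : R) (phi : int -> R)
    (n b : nat) (s : seq (int * int)) :
  -2 < lambda < 2 -> `|center lambda eta| <= b%:R ->
  uniq s -> (forall v, periodic lambda eta v -> v \in s) ->
  (forall y, `|phi y| <= C) ->
  (forall y, e + (phi (y + 1) - phi y) <= (2 %| row_floor lambda eta y)%Z%:R) ->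
  0 < sigma < 1 -> sigma ^+ 2 = (2 - lambda) / 4 -> 1 <= sigma * n%:R ->
  0 <= e <= 1 / 2 ->
  let k := codisc lambda in let N : R := n%:R in
  let L : R := 2 * (N + b%:R) + 1 in
  4 / 3 * k * (sigma + e - 1 / 2) * N ^+ 3 <=
  (2 + lambda) * (L * (2 * (sigma * N))) + k * (L * N) +
  k * (2 * C * N ^+ 2 + L * (C * (2 * N + 1))) + L / 16 +
  L * (2 * N + 3 / 2) + 2 * (size s)%:R * (k * N ^+ 2).
Proof.
move=> lam cb us s_per phiC step /andP[sg0 sg1] sg2 sN1 /andP[e0 e1].
set k := codisc lambda; set N : R := n%:R; set L : R := 2 * (N + b%:R) + 1.
rewrite /=.
have := sum_symmetric_weight n lam cb us s_per; rewrite -/k -/N.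
have := half_turn_sum n b lam phiC step; rewrite -/k -/N -/L.
have k0 : 0 < k := codisc_gt0 lam.
have N0 : 0 <= N := ler0n _ _.
have sNN : sigma * N <= N by rewrite ler_piMl// ltW.
have := @sum_rows R (sigma * N) (center lambda eta) n b sN1 sNN cb.
have := @sum_rows R N (center lambda eta) n b (le_trans sN1 sNN) (lexx _) cb.
rewrite -/N -/L.
have lam' := lam; move: lam' => /andP[lam_gt lam_lt].
have -> : \sum_(y <- ints (n + b)) weight lambda eta (k * N ^+ 2) (y, y) =
   (2 + lambda) * \sum_(y <- ints (n + b))
     parabola (sigma * N) (y%:~R - center lambda eta).
  rewrite mulr_sumr; apply: eq_bigr => y _; exact: weight_diag.
have : \sum_(v <- box (n + b)) Num.max 0 (weight lambda eta (k * N ^+ 2) v -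
        weight lambda eta (k * N ^+ 2) (F lambda eta v)) <=
    k / 2 * \sum_(y <- ints (n + b)) parabola N (y%:~R - center lambda eta)
    + L * (2 * N + 3 / 2).
  rewrite big_allpairs_dep.
  have -> : L * (2 * N + 3 / 2) = \sum_(y <- ints (n + b)) (2 * N + 3 / 2).
    by rewrite sum_ints sumr_const_nat subn0 -[RHS]mulr_natl natr_width.
  rewrite mulr_sumr -big_split; apply: ler_sum => y _.
  by rewrite [k / 2 * _]mulrAC; exact: row_decrease.
set P2 := \sum_(y <- _) parabola N _.
set P1 := \sum_(y <- _) parabola (sigma * N) _.
set X := \sum_(v <- box _) _.
set Y := \sum_(y <- _ | _) _.
move=> leX; rewrite !ler_norml => /andP[P2_ge P2_le] /andP[P1_ge P1_le] leY.
have : (2 + lambda) * (4 / 3 * (sigma * N) ^+ 3 - L * (2 * (sigma * N)))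
    <= (2 + lambda) * P1.
  by rewrite ler_wpM2l//; lra.
have : k * (1 / 2 - e) * P2 <= k * (1 / 2 - e) * (4 / 3 * N ^+ 3 + L * (2 * N)).
  by rewrite ler_wpM2l ?mulr_ge0 ?(ltW k0)//; lra.
have -> : (2 + lambda) * (4 / 3 * (sigma * N) ^+ 3 - L * (2 * (sigma * N))) =
  4 / 3 * k * sigma * N ^+ 3 - (2 + lambda) * (L * (2 * (sigma * N))).
  have -> : (sigma * N) ^+ 3 = sigma ^+ 2 * sigma * N ^+ 3 by ring.
  by rewrite sg2 /k /codisc; field.
have : 0 <= k * (e * (L * (2 * N))).
  by rewrite !mulr_ge0 ?(ltW k0)// /L; have := ler0n R b; lra.
move: leX leY; rewrite -/X -/Y.
by lra.
Qed.

(** If the periodic points were finite in number, [energy_balance] would bound a positive multiple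
    of n^3 by O(n^2). *)
Lemma infinite_periodic (R : realType) (lambda eta e C : R) (phi : int -> R) :
  -2 < lambda < 2 -> 0 <= e <= 1 / 2 -> 1 / 2 < Num.sqrt (2 - lambda) / 2 + e ->
  (forall y, `|phi y| <= C) ->
  (forall y, e + (phi (y + 1) - phi y) <= (2 %| row_floor lambda eta y)%Z%:R) ->
  infinite_set (periodic lambda eta).
Proof.
move=> lam e01 gap phiC step /finite_seqP[s0 per].
have s_per v : periodic lambda eta v -> v \in undup s0.
  by rewrite mem_undup => pv; have : [set` s0] v by rewrite -per.
set sigma := Num.sqrt (2 - lambda) / 2 in gap.
have lam2 : 0 <= 2 - lambda by case/andP: lam => ? ?; lra.
have sg2 : sigma ^+ 2 = (2 - lambda) / 4.
  by rewrite expr_div_n sqr_sqrtr//; field.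
have sg0 : 0 < sigma by rewrite divr_gt0// sqrtr_gt0; case/andP: lam => ? ?; lra.
have sg1 : sigma < 1 by case/andP: lam => ? ?; nra.
set b := (Num.truncn `|center lambda eta|).+1.
have cb : `|center lambda eta| <= b%:R by apply/ltW/truncnS_gt.
have k0 := codisc_gt0 lam.
have C0 : 0 <= C by apply: le_trans (phiC 0).
set k := codisc lambda in k0; set K : R := (size (undup s0))%:R.
(* [B] is chosen so that the number of rows is at most [B * N], and [A] so that all error terms
   together are at most [A * N ^ 2]. *)
pose B : R := 2 * b%:R + 3.
pose A := (2 + lambda) * (B * (2 * sigma)) + k * B + k * (2 * C + B * (C * 3))
  + B + B * 4 + 2 * K * k.
have B0 : 3 <= B by rewrite /B lerDr mulr_ge0.
have A0 : 0 <= A.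
  have K0 : 0 <= K := ler0n _ _.
  have ? : 0 <= 2 + lambda by case/andP: lam => ? ?; lra.
  have ? : 0 <= B by lra.
  have [? ?] : 0 <= k /\ 0 <= sigma by lra.
  have ? : 0 <= B * (C * 3) by rewrite !mulr_ge0.
  have ? : 0 <= 2 * C + B * (C * 3) by lra.
  rewrite /A; clearbody sigma B; do 5 ?[apply: addr_ge0]; rewrite ?mulr_ge0//; lra.
pose c := 4 / 3 * k * (sigma + e - 1 / 2).
have c0 : 0 < c by rewrite /c !mulr_gt0//; lra.
set n := (Num.truncn (A / c + sigma^-1)).+1.
have n_gt : A / c + sigma^-1 < n%:R by exact: truncnS_gt.
have Ac0 : 0 <= A / c := divr_ge0 A0 (ltW c0).
have sn : 1 <= sigma * n%:R.
  by rewrite mulrC -ler_pdivrMr// div1r; lra.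
have An : A < c * n%:R.
  rewrite mulrC -ltr_pdivrMr//; apply: le_lt_trans n_gt.
  by rewrite lerDl invr_ge0 ltW.
have N1 : 1 <= n%:R :> R by rewrite ler1n.
have := @energy_balance R lambda eta e C sigma phi n b _ lam cb
  (undup_uniq s0) s_per phiC step _ sg2 sn e01.
rewrite sg0 sg1 => /(_ isT) /=; rewrite -/k -/K -/c.
set N : R := n%:R in An N1 *; set L := 2 * (N + b%:R) + 1.
have L0 : 0 <= L by rewrite /L; have := ler0n R b; lra.
have LB : L <= B * N by rewrite /L /B; have := ler0n R b; nra.
apply/negP; rewrite -ltNge.
apply: (@le_lt_trans _ _ (A * N ^+ 2)); last first.
  have -> : c * N ^+ 3 = c * N * N ^+ 2 by ring.
  by rewrite ltr_pM2r// exprn_gt0//; lra.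
have lam0 : 0 <= 2 + lambda by case/andP: lam => ? ?; lra.
have LN m r : 0 <= m -> 0 <= r -> r <= m * N -> L * r <= B * m * N ^+ 2.
  move=> m0 r0 r_le; have -> : B * m * N ^+ 2 = (B * N) * (m * N) by ring.
  exact: ler_pM.
have h1 : (2 + lambda) * (L * (2 * (sigma * N))) <=
    (2 + lambda) * (B * (2 * sigma) * N ^+ 2).
  by apply: ler_wpM2l => //; apply: LN; nra.
have h2 : k * (L * N) <= k * (B * 1 * N ^+ 2).
  by apply: ler_wpM2l; [exact: ltW|apply: LN; lra].
have h3 : k * (L * (C * (2 * N + 1))) <= k * (B * (C * 3) * N ^+ 2).
  by apply: ler_wpM2l; [exact: ltW|apply: LN; nra].
have h4 : L * (1 / 16) <= B * 1 * N ^+ 2 by apply: LN; lra.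
have h5 : L * (2 * N + 3 / 2) <= B * 4 * N ^+ 2 by apply: LN; lra.
by rewrite /A; lra.
Qed.

Theorem theorem2 (R : realType) (lambda eta : R)
    (hlambda : -2 < lambda < 2) :
  infinite_set (periodic_orbits lambda eta).
Proof.
move=> /finite_periodic.
have [lt1|gt1|->] := ltgtP lambda 1.
- apply: (@infinite_periodic _ _ _ 0 0 (fun=> 0)) => //.
  + by apply/andP; split; lra.
  + have : 1 < Num.sqrt (2 - lambda) by rewrite -[ltLHS]sqrtr1 ltr_sqrt; lra.
    by lra.
  + by move=> y; rewrite normr0.
  + by move=> y; rewrite subrr addr0 ler0n.
- have lam : 1 < lambda < 2 by rewrite gt1; case/andP: hlambda.
  have [_ lt2] := andP lam.
  apply: (@infinite_periodic _ _ _ ((lambda - 1) / 2)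
    (1 + (1 + (2 - lambda)) / (2 * (2 - lambda))) (defect_phase lambda eta)) => //.
  + by apply/andP; split; lra.
  (* With [r = sqrt eps] the gap condition becomes [0 < r * (1 - r)]. *)
  + have eps0 : 0 < 2 - lambda by lra.
    have := sqr_sqrtr (ltW eps0); have : 0 < Num.sqrt (2 - lambda).
      by rewrite sqrtr_gt0.
    by move: (Num.sqrt _) => r ? ?; nra.
  + by move=> y; exact: defect_phase_bound.
  + by move=> y; exact: defect_phase_step.
- move=> fin; apply: infinite_int2; apply: sub_finite_set fin => p _.
  exact: periodic_lambda1.
Qed.
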